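(* For $2\le N\le 30$, let $\mathrm{OCS}(N)$ be the number of orthogonal circulant symmetric real $N\times N$ matrices, let $\mathrm{OCSN}(N)$ be the number of those having all entries nonzero, and let $\mathrm{AHM}(N)$ be the number of circulant symmetric almost Hadamard $N\times N$ matrices. Then the triples $(\mathrm{OCS}(N),\mathrm{OCSN}(N),\mathrm{AHM}(N))$ are: $N=2$: $(4,0,0)$; $N=3$: $(4,2,2)$; $N=4$: $(8,4,4)$; $N=5$: $(8,6,6)$; $N=6$: $(16,8,8)$; $N=7$: $(16,14,14)$; $N=8$: $(32,16,8)$; $N=9$: $(32,22,22)$; $N=10$: $(64,40,24)$; $N=11$: $(64,62,42)$; $N=12$: $(128,44,36)$; $N=13$: $(128,126,108)$; $N=14$: $(256,176,104)$; $N=15$: $(256,186,68)$; $N=16$: $(512,296,136)$; $N=17$: $(512,510,302)$; $N=18$: $(1024,536,152)$; $N=19$: $(1024,1022,404)$; $N=20$: $(2048,1220,404)$; $N=21$: $(2048,1642,418)$; $N=22$: $(4096,3088,728)$; $N=23$: $(4096,4094,1410)$; $N=24$: $(8192,4000,856)$; $N=25$: $(8192,7734,1780)$; $N=26$: $(16384,12688,2504)$; $N=27$: $(16384,13586,3098)$; $N=28$: $(32768,22324,4140)$; $N=29$: $(32768,32766,6740)$; $N=30$: $(65536,39080,5608)$.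
   Context: A matrix $U\in M_N(\mathbb R)$ is circulant if $U_{ij}=\gamma_{j-i}$ for some vector $\gamma$, with indices taken in $\mathbb Z/N\mathbb Z$. A matrix $H\in M_N(\mathbb R)$ is called almost Hadamard if $U=H/\sqrt N$ is orthogonal, all $U_{ij}\neq 0$, and the matrix $SU^t$, where $S_{ij}=\mathrm{sgn}(U_{ij})$, is (symmetric and) positive definite, in the strict sense. *)

(* Defs.v *)
From mathcomp Require Import all_boot all_order all_algebra.
From mathcomp Require Import all_classical all_reals.

Set Implicit Arguments.
Unset Strict Implicit.
Unset Printing Implicit Defensive.
Set Warnings "-abstract-large-number".

Import Order.TTheory GRing.Theory Num.Theory.
Local Open Scope classical_set_scope.
Local Open Scope ring_scope.

(* 'Z_1 is Z/2Z, but the difference below is then always 0, so the definition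
   keeps its intended meaning for N = 1. *)
Definition circulant (R : realType) (N : nat) (U : 'M[R]_N) : Prop :=
  exists gamma : 'Z_N -> R, forall i j : 'I_N, U i j = gamma (j%:R - i%:R).

Definition orthogonal_mx (R : realType) (N : nat) (U : 'M[R]_N) : Prop :=
  U *m U^T = 1%:M.

Definition symmetric_mx (R : realType) (N : nat) (U : 'M[R]_N) : Prop :=
  U^T = U.

Definition nonzero_entries (R : realType) (N : nat) (U : 'M[R]_N) : Prop :=
  forall i j : 'I_N, U i j != 0.

Definition positive_definite (R : realType) (N : nat) (A : 'M[R]_N) : Prop :=
  symmetric_mx A /\
  forall x : 'cV[R]_N, x != 0 -> 0 < (x^T *m A *m x) 0 0.

Definition almost_hadamard (R : realType) (N : nat) (H : 'M[R]_N) : Prop :=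
  let U := (Num.sqrt N%:R)^-1 *: H in
  let S := map_mx Num.sg U in
  [/\ orthogonal_mx U, nonzero_entries U & positive_definite (S *m U^T)].

Definition OCS (R : realType) (N : nat) : set 'M[R]_N :=
  [set U | [/\ orthogonal_mx U, circulant U & symmetric_mx U]].
Arguments OCS : clear implicits.

Definition OCSN (R : realType) (N : nat) : set 'M[R]_N :=
  [set U | OCS R N U /\ nonzero_entries U].
Arguments OCSN : clear implicits.

Definition AHM (R : realType) (N : nat) : set 'M[R]_N :=
  [set H | [/\ circulant H, symmetric_mx H & almost_hadamard H]].
Arguments AHM : clear implicits.

Definition count_table (N : nat) : nat * nat * nat :=
  match N with
  | 2 => (4, 0, 0)
  | 3 => (4, 2, 2)
  | 4 => (8, 4, 4)
  | 5 => (8, 6, 6)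
  | 6 => (16, 8, 8)
  | 7 => (16, 14, 14)
  | 8 => (32, 16, 8)
  | 9 => (32, 22, 22)
  | 10 => (64, 40, 24)
  | 11 => (64, 62, 42)
  | 12 => (128, 44, 36)
  | 13 => (128, 126, 108)
  | 14 => (256, 176, 104)
  | 15 => (256, 186, 68)
  | 16 => (512, 296, 136)
  | 17 => (512, 510, 302)
  | 18 => (1024, 536, 152)
  | 19 => (1024, 1022, 404)
  | 20 => (2048, 1220, 404)
  | 21 => (2048, 1642, 418)
  | 22 => (4096, 3088, 728)
  | 23 => (4096, 4094, 1410)
  | 24 => (8192, 4000, 856)
  | 25 => (8192, 7734, 1780)
  | 26 => (16384, 12688, 2504)
  | 27 => (16384, 13586, 3098)
  | 28 => (32768, 22324, 4140)
  | 29 => (32768, 32766, 6740)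
  | 30 => (65536, 39080, 5608)
  | _ => (0, 0, 0)
  end%N.

(* Main.v *)
From HB Require Import structures.
From Stdlib Require Import NArith ZArith.
Require Import Defs.
From mathcomp Require Import all_boot all_order all_algebra.
From mathcomp Require Import all_classical all_reals.
From mathcomp Require Import ssrZ ring lra zify.

(* A symmetric circulant matrix is diagonalised by the cosine vectors, so the
   orthogonal ones correspond to the even functions q : Z/N -> {1, -1}, that is
   to sign vectors of length N/2 + 1. The entries of such a matrix are, up to
   the factor 2N, the sums T(q)_j = sum_k q_k 2cos(2 pi jk/N), and S U^t is
   again symmetric circulant, with eigenvalues T(sgn T(q))_k q_k up to a
   positive factor. So the last two counts are those of the q with all
   T(q)_j nonzero and of the fixed points of q -> sgn T(sgn T(q)). Each T(q)_j is
   an integer polynomial in x = 2cos(2 pi/N): it is zero if that polynomial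
   vanishes modulo the minimal polynomial of x, and otherwise a fixed-point
   approximation with a proved error bound gives its sign. No trigonometry is
   needed: x is the root of the minimal polynomial found by the intermediate
   value theorem, and 2cos(2 pi k/N) is defined by the Chebyshev recurrence,
   whose periodicity is checked modulo the minimal polynomial. *)

Set Implicit Arguments.
Unset Strict Implicit.
Unset Printing Implicit Defensive.

Import Order.TTheory GRing.Theory Num.Theory.
Local Open Scope classical_set_scope.
Local Open Scope card_scope.
Local Open Scope ring_scope.

(* [%Z] denotes MathComp's [int_scope] here. *)
Delimit Scope Z_scope with ZZ.

(** * Cosine transform on Z/N and the spectra of symmetric circulant matrices *)

Section CosineTransform.
Variables (R : realType) (n : nat).
Local Notation Zn := 'Z_n.+2.
Local Notation NR := (n.+2%:R : R).
(** [c a] plays the role of cos(2 pi a / N); the hypotheses are the product formula and the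
    vanishing of the nontrivial character sums. *)
Variable c : Zn -> R.
Hypothesis c0 : c 0 = 1.
Hypothesis cM : forall a b, c (a + b) + c (a - b) = 2 * c a * c b.
Hypothesis csum : forall a, a != 0 -> \sum_k c (a * k) = 0.

Implicit Types (g h q r : Zn -> R).

Definition even_fun g := forall j, g (- j) = g j.
(** For even [g] the sine part cancels, so this is the discrete Fourier transform. *)
Definition dft g k : R := \sum_j g j * c (j * k).
Definition conv g h m : R := \sum_j g j * h (m - j).
Definition circ g : 'M[R]_n.+2 := \matrix_(i, j) g (j - i).
(** By [dftK] the first row is the inverse transform of [q], so for even [q] the eigenvalues are the
    [q k]. *)
Definition spectral_mx q := circ (fun j => dft q j / NR).

Lemma NR_neq0 : NR != 0. Proof. by rewrite pnatr_eq0. Qed.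

Lemma cN : even_fun c.
Proof. by move=> b; have := cM 0 b; rewrite add0r sub0r c0; lra. Qed.

Lemma sum_oppZ g : \sum_j g (- j) = \sum_j g j.
Proof. by rewrite [RHS](reindex_inj oppr_inj). Qed.

Lemma sum_subZ g m : \sum_j g (j - m) = \sum_j g j.
Proof. by rewrite [RHS](reindex_inj (addIr (- m))). Qed.

Lemma sum_addZ g m : \sum_j g (j + m) = \sum_j g j.
Proof. by rewrite [RHS](reindex_inj (addIr m)). Qed.

Lemma eq_dft g h : g =1 h -> dft g =1 dft h.
Proof. by move=> gh k; apply: eq_bigr => j _; rewrite gh. Qed.

Lemma dft_even g : even_fun (dft g).
Proof. by move=> k; apply: eq_bigr => j _; rewrite mulrN cN. Qed.

Lemma sum_cos a : \sum_k c (a * k) = NR * (a == 0)%:R.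
Proof.
case: eqVneq => [->|/csum ->]; last by rewrite mulr0.
under eq_bigr do rewrite mul0r c0.
by rewrite sumr_const cardT size_enum_ord mulr1.
Qed.

(** The product formula splits [c (i * k) * c (k * j)] into halves whose sums over [k] select i = -j
    and i = j; evenness of [g] merges the two. *)
Lemma dftK g : even_fun g -> forall j, dft (dft g) j = NR * g j.
Proof.
move=> ge j; rewrite /dft.
under eq_bigr do rewrite mulr_suml.
rewrite exchange_big /=.
have E i : \sum_k g i * c (i * k) * c (k * j) =
  g i * (NR * (i == - j)%:R) / 2 + g i * (NR * (i == j)%:R) / 2.
  transitivity (g i / 2 * (\sum_k c ((i + j) * k) + \sum_k c ((i - j) * k))).
    rewrite -big_split mulr_sumr; apply: eq_bigr => k _ /=.
    rewrite mulrDl mulrBl (mulrC k j) cM.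
    by move: (c (i * k)) (c (j * k)) => x y; field.
  by rewrite !sum_cos subr_eq0 addr_eq0; field.
under eq_bigr do rewrite E.
(* The two halves are isolated separately, so the case j = -j needs no special treatment. *)
rewrite big_split /= (bigD1 (- j)) //= big1 => [|i /negPf->]; last first.
  by rewrite !mulr0 mul0r.
rewrite (bigD1 j) //= big1 => [|i /negPf->]; last by rewrite !mulr0 mul0r.
by rewrite !eqxx ge !mulr1 !addr0; field.
Qed.

(** Since [g] is even, shifting by [i] or by [- i] gives the same sum, and the product formula
    evaluates the total of the two. *)
Lemma dft_shift g : even_fun g -> forall i k,
  \sum_j g (j - i) * c (j * k) = dft g k * c (i * k).
Proof.
move=> ge i k.
rewrite -(sum_addZ _ i); under eq_bigr do rewrite addrK.
have E : \sum_j g j * c ((j + i) * k) = \sum_j g j * c ((j - i) * k).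
  rewrite -sum_oppZ; apply: eq_bigr => j _.
  by rewrite ge -cN -mulNr opprD !opprK addrC.
have : \sum_j g j * c ((j + i) * k) + \sum_j g j * c ((j - i) * k) =
   2 * (dft g k * c (i * k)).
  rewrite -big_split /= mulr_suml mulr_sumr; apply: eq_bigr => j _.
  by rewrite -mulrDr mulrDl mulrBl cM; ring.
by rewrite -E; lra.
Qed.

Lemma conv_even g h : even_fun g -> even_fun h -> even_fun (conv g h).
Proof.
move=> ge he m; rewrite /conv -sum_oppZ; apply: eq_bigr => j _.
by rewrite ge -he opprD !opprK.
Qed.

Lemma dft_conv g h : even_fun g -> even_fun h ->
  forall k, dft (conv g h) k = dft g k * dft h k.
Proof.
move=> ge he k; rewrite /dft /conv.
under eq_bigr do rewrite mulr_suml.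
rewrite exchange_big /= [RHS]mulr_suml; apply: eq_bigr => j _.
under eq_bigr do rewrite -mulrA.
by rewrite -mulr_sumr dft_shift // -mulrA [dft h k * _]mulrC.
Qed.

Lemma eq_circ g h : g =1 h -> circ g = circ h.
Proof. by move=> gh; apply/matrixP => i j; rewrite !mxE. Qed.

Lemma circ_inj g h : circ g = circ h -> g =1 h.
Proof. by move=> /matrixP gh j; have := gh 0 j; rewrite !mxE subr0. Qed.

Lemma circM g h : circ g *m circ h = circ (conv g h).
Proof.
apply/matrixP => i m; rewrite !mxE /conv -[RHS](sum_addZ _ (- i)).
by apply: eq_bigr => j _; rewrite !mxE; congr (_ * h _); rewrite opprB addrA subrK.
Qed.

Lemma circ_sym g : symmetric_mx (circ g) <-> even_fun g.
Proof.
split=> [/matrixP gE j|ge]; first by have := gE 0 j; rewrite !mxE sub0r subr0.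
by apply/matrixP => i j; rewrite !mxE -ge opprB.
Qed.

Lemma circulantP (U : 'M[R]_n.+2) : circulant U <-> exists g, U = circ g.
Proof.
split=> [[g gU]|[g ->]]; exists g.
  by apply/matrixP => i j; rewrite gU mxE !(natr_Zp (_ : Zn)).
by move=> i j; rewrite mxE !(natr_Zp (_ : Zn)).
Qed.

Lemma spectral_even q : even_fun (fun j => dft q j / NR).
Proof. by move=> j; rewrite dft_even. Qed.

Lemma dft_spectral q : even_fun q -> dft (fun j => dft q j / NR) =1 q.
Proof.
move=> qe k; rewrite -[RHS](mulKf NR_neq0) -dftK // /dft mulr_sumr.
by apply: eq_bigr => j _; rewrite mulrA [_^-1 * _]mulrC.
Qed.

Lemma eq_spectral q r : q =1 r -> spectral_mx q = spectral_mx r.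
Proof. by move=> qr; apply: eq_circ => j; rewrite (eq_dft qr). Qed.

Lemma spectral_inj q r : even_fun q -> even_fun r ->
  spectral_mx q = spectral_mx r -> q =1 r.
Proof.
move=> qe re /circ_inj qr k.
by rewrite -dft_spectral // -[RHS]dft_spectral //; apply: eq_dft.
Qed.

Lemma circ_spectral g : even_fun g -> circ g = spectral_mx (dft g).
Proof. by move=> ge; apply: eq_circ => j; rewrite dftK // mulrC mulKf ?NR_neq0. Qed.

Lemma spectral_sym q : (spectral_mx q)^T = spectral_mx q.
Proof. by apply/circ_sym/spectral_even. Qed.

Lemma spectralM q r : even_fun q -> even_fun r ->
  spectral_mx q *m spectral_mx r = spectral_mx (fun k => q k * r k).
Proof.
move=> qe re; rewrite circM circ_spectral; last first.
  by apply: conv_even; apply: spectral_even.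
apply: eq_spectral => k.
by rewrite dft_conv ?dft_spectral //; apply: spectral_even.
Qed.

Lemma spectral1 : spectral_mx (fun=> 1) = 1%:M.
Proof.
apply/matrixP => i j; rewrite !mxE /dft.
under eq_bigr do rewrite mul1r mulrC.
by rewrite sum_cos mulrC mulKf ?NR_neq0 // subr_eq0 eq_sym.
Qed.

(** The matrix is symmetric, so U U^t has eigenvalues [q k ^+ 2], while the identity has constant
    spectrum 1. *)
Lemma orthogonal_spectral q : even_fun q ->
  orthogonal_mx (spectral_mx q) <-> forall k, q k ^+ 2 = 1.
Proof.
move=> qe; rewrite /orthogonal_mx spectral_sym spectralM // -spectral1; split.
  by move=> /spectral_inj H k; rewrite expr2 H // => j; rewrite qe.
by move=> q2; apply: eq_spectral => k; rewrite -expr2 q2.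
Qed.

Lemma spectral_eigen q k : even_fun q ->
  spectral_mx q *m (\col_j c (j * k)) = q k *: (\col_j c (j * k)).
Proof.
move=> qe; apply/matrixP => i j; rewrite !mxE.
under eq_bigr do rewrite !mxE.
by rewrite (dft_shift (spectral_even q)) dft_spectral.
Qed.

Lemma sqnorm_ge0 m (x : 'cV[R]_m) : 0 <= (x^T *m x) 0 0.
Proof. by rewrite mxE sumr_ge0 // => i _; rewrite !mxE -expr2 sqr_ge0. Qed.

Lemma sqnorm_gt0 m (x : 'cV[R]_m) : x != 0 -> 0 < (x^T *m x) 0 0.
Proof.
move=> x0; rewrite lt_neqAle sqnorm_ge0 andbT eq_sym.
apply: contra x0; rewrite mxE psumr_eq0 => [/allP xE|i _]; last first.
  by rewrite !mxE -expr2 sqr_ge0.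
apply/eqP/matrixP => i j; rewrite ord1 mxE.
by have /eqP := xE i (mem_index_enum i); rewrite !mxE => /eqP; rewrite mulf_eq0 orbb => /eqP.
Qed.

(** Testing on the cosine eigenvector, whose coordinate 0 is 1, gives each [q k > 0]. Conversely the
    matrix is the square of the symmetric one with spectrum sqrt(q), which is invertible with
    inverse spectrum 1/sqrt(q). *)
Lemma pos_def_spectral q : even_fun q ->
  positive_definite (spectral_mx q) <-> forall k, 0 < q k.
Proof.
move=> qe; split=> [[_ pd] k|q_gt0].
  pose x : 'cV[R]_n.+2 := \col_j c (j * k).
  have x0 : x != 0.
    apply/eqP => /matrixP/(_ 0 0); rewrite !mxE mul0r c0 => /eqP.
    by rewrite oner_eq0.
  have := pd x x0; rewrite -mulmxA spectral_eigen // -scalemxAr mxE.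
  by rewrite pmulr_lgt0 // sqnorm_gt0.
split=> [|x x0]; first exact: spectral_sym.
pose s k := Num.sqrt (q k).
have se : even_fun s by move=> k; rewrite /s qe.
have sVe : even_fun (fun k => (s k)^-1) by move=> k; rewrite se.
have s_neq0 k : s k != 0 by rewrite gt_eqF // sqrtr_gt0.
have -> : spectral_mx q = spectral_mx s *m spectral_mx s.
  rewrite spectralM //; apply: eq_spectral => k.
  by rewrite -expr2 sqr_sqrtr // ltW.
have -> : x^T *m (spectral_mx s *m spectral_mx s) *m x =
    (spectral_mx s *m x)^T *m (spectral_mx s *m x).
  by rewrite trmx_mul spectral_sym !mulmxA.
apply: sqnorm_gt0; apply: contra x0 => /eqP sx0.
suff -> : x = spectral_mx (fun k => (s k)^-1) *m (spectral_mx s *m x).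
  by rewrite sx0 mulmx0.
rewrite mulmxA spectralM // -[LHS]mul1mx -spectral1; congr (_ *m _).
by apply: eq_spectral => k; rewrite mulVf.
Qed.

Lemma OCSP (U : 'M[R]_n.+2) : OCS R n.+2 U <->
  exists q, [/\ even_fun q, forall k, q k ^+ 2 = 1 & U = spectral_mx q].
Proof.
split=> [[oU /circulantP[g Ug] sU]|[q [qe q2 ->]]].
  have ge : even_fun g by apply/circ_sym; rewrite -Ug.
  exists (dft g); split; [exact: dft_even| |by rewrite Ug circ_spectral].
  by apply/orthogonal_spectral; [exact: dft_even|rewrite -circ_spectral // -Ug].
split; [exact/orthogonal_spectral| |exact: spectral_sym].
by apply/circulantP; eexists.
Qed.

Lemma nonzero_spectral q :
  nonzero_entries (spectral_mx q) <-> forall k, dft q k != 0.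
Proof.
have E k : (dft q k / NR != 0) = (dft q k != 0).
  by rewrite mulf_eq0 invr_eq0 (negPf NR_neq0) orbF.
split=> nz => [k|i j]; last by rewrite mxE E.
by have := nz 0 k; rewrite mxE subr0 E.
Qed.

(** The eigenvalues of S U^t: the sign matrix S has first row [Num.sg (dft q j)], since the factor
    1/N does not affect signs. *)
Definition sgn_spectrum q k := dft (fun j => Num.sg (dft q j)) k * q k.

Lemma AHMP (H : 'M[R]_n.+2) : AHM R n.+2 H <->
  exists q, [/\ even_fun q, forall k, q k ^+ 2 = 1, forall k, dft q k != 0,
    forall k, 0 < sgn_spectrum q k & H = Num.sqrt NR *: spectral_mx q].
Proof.
have s0 : Num.sqrt NR != 0 by rewrite gt_eqF // sqrtr_gt0 ltr0n.
have pdE q : even_fun q -> positive_definite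
    (map_mx Num.sg (spectral_mx q) *m (spectral_mx q)^T) <->
    forall k, 0 < sgn_spectrum q k.
  move=> qe; rewrite spectral_sym.
  have sge : even_fun (fun j => Num.sg (dft q j)) by move=> j; rewrite dft_even.
  have -> : map_mx Num.sg (spectral_mx q) =
      spectral_mx (dft (fun j => Num.sg (dft q j))).
    rewrite -circ_spectral //; apply/matrixP => i j; rewrite !mxE sgrM.
    by rewrite [Num.sg _^-1]gtr0_sg ?mulr1 // invr_gt0 ltr0n.
  rewrite spectralM //; last exact: dft_even.
  by apply: pos_def_spectral => k; rewrite dft_even qe.
split.
  case=> cH sH [].
  set U := _ *: H; have HU : H = Num.sqrt NR *: U by rewrite scalerA divff ?scale1r.
  move=> oU nU pdU.
  have [|q [qe q2 Uq]] := (OCSP U).1.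
    split=> //; last by rewrite /symmetric_mx linearZ /= sH.
    by have [g gH] := cH; exists (fun j => (Num.sqrt NR)^-1 * g j) => i j; rewrite mxE gH.
  exists q; split=> //; last by rewrite HU Uq.
    by apply/nonzero_spectral; rewrite -Uq.
  by apply/pdE => //; rewrite -Uq.
case=> q [qe q2 nz pd HE].
have UE : (Num.sqrt NR)^-1 *: H = spectral_mx q.
  by rewrite HE scalerA mulVf ?scale1r.
have [oq [g gE] sq] : OCS R n.+2 (spectral_mx q) by apply/OCSP; exists q.
split.
- by exists (fun j => Num.sqrt NR * g j) => i j; rewrite HE mxE gE.
- by rewrite /symmetric_mx HE linearZ /= sq.
by split; rewrite UE //; [exact/nonzero_spectral|exact/pdE].
Qed.

End CosineTransform.

(** * Enumeration of sign vectors and cardinalities as counts *)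

Fixpoint bitseqs n : seq bitseq :=
  if n is n'.+1 then map (cons true) (bitseqs n') ++ map (cons false) (bitseqs n')
  else [:: [::]].

Lemma mem_bitseqs n b : (b \in bitseqs n) = (size b == n).
Proof.
elim: n b => [|n IH] [|x b] /=; rewrite ?mem_cat ?inE //.
  by apply/norP; split; apply/mapP => -[].
apply/idP/idP => [/orP[]/mapP[b' + [_ ->]]|]; rewrite ?IH // => sb.
by case: x; rewrite map_f ?orbT // IH.
Qed.

Lemma size_bitseqs n : size (bitseqs n) = (2 ^ n)%N.
Proof.
by elim: n => //= n IH; rewrite size_cat !size_map IH addnn -mul2n expnS.
Qed.

Lemma uniq_bitseqs n : uniq (bitseqs n).
Proof.
elim: n => //= n IH; rewrite cat_uniq !map_inj_uniq ?IH //=; try by move=> ? ? [].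
by rewrite andbT; apply/hasPn => _ /mapP[b _ ->]; apply/mapP => -[].
Qed.

Lemma count_negb_bitseqs (P : pred bitseq) n :
  count (P \o map negb) (bitseqs n) = count P (bitseqs n).
Proof.
rewrite -count_map; apply: permP P; apply: uniq_perm; rewrite ?uniq_bitseqs //.
  by rewrite map_inj_uniq ?uniq_bitseqs //; apply/inj_map/negb_inj.
move=> b; rewrite mem_bitseqs; apply/mapP/idP => [[b' + ->]|/eqP sb].
  by rewrite mem_bitseqs size_map.
exists (map negb b); rewrite ?mem_bitseqs ?size_map ?sb //.
by rewrite -map_comp map_id_in // => x _ /=; rewrite negbK.
Qed.

(** Negation maps the vectors starting with [false] onto those starting with [true], so half of the
    enumeration suffices. *)
Lemma count_bitseqs_double (P : pred bitseq) n :
  (forall b, size b = n.+1 -> P (map negb b) = P b) ->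
  count P (bitseqs n.+1) = (count (P \o cons true) (bitseqs n)).*2.
Proof.
move=> PN; rewrite /= count_cat !count_map -addnn; congr addn.
rewrite -count_negb_bitseqs; apply: eq_in_count => b.
by rewrite mem_bitseqs => /eqP sb; rewrite /= -[RHS]PN //= sb.
Qed.

Lemma card_eq_bitseqs (T : Type) (A : set T) (f : bitseq -> T) (P : pred bitseq) n :
  (forall x, A x <-> exists b, [/\ size b = n, P b & x = f b]) ->
  (forall b b', size b = n -> size b' = n -> f b = f b' -> b = b') ->
  A #= `I_(count P (bitseqs n)).
Proof.
move=> AP f_inj; rewrite -size_filter.
set s := seq.filter P (bitseqs n).
have us : uniq s by rewrite filter_uniq ?uniq_bitseqs.
have sP b : (b \in s) = P b && (size b == n) by rewrite mem_filter mem_bitseqs.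
have nthP i : (i < size s)%N -> P (nth [::] s i) /\ size (nth [::] s i) = n.
  by move=> /(mem_nth [::]); rewrite sP => /andP[? /eqP].
have -> : A = (fun i => f (nth [::] s i)) @` `I_(size s).
  apply/seteqP; split=> [x /AP[b [sb Pb ->]]|x [i /= /nthP[? ?] <-]].
    have bs : b \in s by rewrite sP Pb sb eqxx.
    by exists (index b s); rewrite /= ?index_mem // nth_index.
  by apply/AP; exists (nth [::] s i).
apply: inj_card_eq => i j; rewrite !inE /= => lti ltj /f_inj E; apply/eqP.
rewrite -(nth_uniq [::] lti ltj us).
by apply/eqP/E; [case: (nthP i lti)|case: (nthP j ltj)].
Qed.

(** * Reduction of the three cardinalities to counts of sign vectors *)

Definition fold_idx N k := minn k (N - k).
(** Size of the class {i, -i} in Z/N, whose representative in 0..N/2 is given by [fold_idx]: for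
    such [i] it is 1 if i = -i and 2 otherwise. *)
Definition fold_mult N i := count (fun k => fold_idx N k == i) (iota 0 N).

Section SignVectors.
Variables (R : realType) (n : nat).
Local Notation Zn := 'Z_n.+2.
Local Notation N := n.+2.
Local Notation M := N./2.+1.
(** Twice the cosine, so that the values are integer polynomials in x = 2cos(2 pi / N). *)
Variable w : nat -> R.
Let c (a : Zn) := w a / 2.
Hypothesis c0 : c 0 = 1.
Hypothesis cM : forall a b : Zn, c (a + b) + c (a - b) = 2 * c a * c b.
Hypothesis csum : forall a : Zn, a != 0 -> \sum_k c (a * k) = 0.

Implicit Types (b : bitseq).

Definition sgb x : R := if x then 1 else -1.
Definition sign_spectrum b (k : Zn) : R := sgb (nth true b (fold_idx N k)).
(** The sum T(q)_j, with the equal terms at k and -k grouped. *)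
Definition sign_sum b (j : nat) : R :=
  \sum_(k < M) (fold_mult N k)%:R * (sgb (nth true b k) * w ((j * k) %% N)).
Definition all_nz b := all (fun j => sign_sum b j != 0) (iota 0 M).
(** A zero sum is also recorded as [false], so this encodes sgn T(q) only under [all_nz b]. *)
Definition signs b : bitseq := mkseq (fun j => 0 < sign_sum b j) M.
Definition is_ahm b := all_nz b &&
  all (fun k => 0 < sign_sum (signs b) k * sgb (nth true b k)) (iota 0 M).

Lemma fold_idx_lt k : (k < N)%N -> (fold_idx N k < M)%N.
Proof. rewrite /fold_idx; lia. Qed.

Lemma fold_idx_id k : (k < M)%N -> fold_idx N k = k.
Proof. rewrite /fold_idx; lia. Qed.

Lemma ltMN k : (k < M)%N -> (k < N)%N.
Proof. lia. Qed.

Lemma fold_idxN (k : Zn) : fold_idx N (- k) = fold_idx N k.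
Proof.
rewrite /fold_idx /= /Zp_trunc /=.
have : (k < n.+2)%N := ltn_ord k; move: (nat_of_ord k) => {}k kN.
have [->|k0] := posnP k; first by rewrite subn0 modnn.
by rewrite modn_small; lia.
Qed.

Lemma sign_spectrum_even b : even_fun (sign_spectrum b).
Proof. by move=> k; rewrite /sign_spectrum fold_idxN. Qed.

Lemma even_fold (T : Type) (g : Zn -> T) : (forall j, g (- j) = g j) ->
  forall k : Zn, g k = g (inZp (fold_idx N k)).
Proof.
move=> ge k; rewrite /fold_idx; case: leqP => [_|kN].
  by congr g; apply: val_inj; rewrite /= modn_small.
by rewrite -ge; congr g; apply: val_inj.
Qed.

Lemma normr_sgb x : `|sgb x| = 1.
Proof. by case: x; rewrite /sgb ?normrN normr1. Qed.

Lemma sgb_inj : injective sgb.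
Proof. by case=> -[] //= /eqP; rewrite ?(eq_sym (-1)) -subr_eq0 opprK -[1+1]/(2%:R) pnatr_eq0. Qed.

Lemma sum_fold (F : nat -> R) :
  \sum_(k : Zn) F (fold_idx N k) = \sum_(i < M) (fold_mult N i)%:R * F i.
Proof.
rewrite (partition_big (fun k : Zn => inord (fold_idx N k) : 'I_M) predT) //=.
apply: eq_bigr => i _.
transitivity (\sum_(k : Zn | fold_idx N k == i) F i).
  have E (k : Zn) : (inord (fold_idx N k) == i) = (fold_idx N k == i).
    by rewrite -val_eqE /= inordK // fold_idx_lt.
  by rewrite (eq_bigl _ _ E); apply: eq_bigr => k /eqP ->.
rewrite sumr_const mulr_natl /fold_mult -val_enum_ord count_map; congr (_ *+ _).
by rewrite cardE enumT size_filter; apply: eq_count.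
Qed.

Lemma dft_sign b (k : Zn) : 2 * dft c (sign_spectrum b) k = sign_sum b (fold_idx N k).
Proof.
rewrite (even_fold (dft_even c0 cM _) k); set j := fold_idx N k.
rewrite /dft mulr_sumr /sign_sum.
rewrite -(sum_fold (fun i => sgb (nth true b i) * w ((j * i) %% N))).
apply: eq_bigr => i _.
rewrite (@even_fold _ (fun i => c (i * inZp j)) _ i); last first.
  by move=> i'; rewrite mulNr (cN c0 cM).
by rewrite /c /= modnMm mulnC mulrA [_ / 2]mulrC mulrCA !mulrA mulVf ?mul1r // pnatr_eq0.
Qed.

Lemma dft_sign_neq0 b :
  all_nz b <-> forall k, dft c (sign_spectrum b) k != 0.
Proof.
have E k : (dft c (sign_spectrum b) k != 0) = (sign_sum b (fold_idx N k) != 0).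
  by rewrite -dft_sign mulf_eq0 pnatr_eq0.
split=> [/allP nz k|nz].
  by rewrite E; apply: nz; rewrite mem_iota fold_idx_lt //= ltn_ord.
apply/allP => j; rewrite mem_iota /= add0n => jM.
by have := nz (inZp j); rewrite E /= modn_small ?ltMN // fold_idx_id.
Qed.

Lemma size_signs b : size (signs b) = M.
Proof. by rewrite size_mkseq. Qed.

Lemma sg_dft b : all_nz b ->
  forall k, Num.sg (dft c (sign_spectrum b) k) = sign_spectrum (signs b) k.
Proof.
move=> /dft_sign_neq0 nz k; rewrite /sign_spectrum nth_mkseq ?fold_idx_lt //.
rewrite -dft_sign pmulr_rgt0 // /sgb; move: (nz k); move: (dft c _ k) => x.
case: (ltrgt0P x) => [x0|x0|->]; rewrite ?eqxx // => _; first by rewrite gtr0_sg.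
by rewrite ltr0_sg.
Qed.

Lemma sign_spectrum_sqr b k : sign_spectrum b k ^+ 2 = 1.
Proof. by rewrite /sign_spectrum /sgb; case: ifP; rewrite ?sqrrN expr1n. Qed.

Definition sign_mx b := spectral_mx c (sign_spectrum b).

Lemma sign_mx_inj b b' : size b = M -> size b' = M ->
  sign_mx b = sign_mx b' -> b = b'.
Proof.
move=> sb sb' /(spectral_inj c0 cM csum (@sign_spectrum_even b) (@sign_spectrum_even b')) E.
apply: (@eq_from_nth _ true) => [|i]; rewrite sb // => iM.
have := E (inZp i); rewrite /sign_spectrum /= modn_small ?ltMN //.
by rewrite fold_idx_id // => /sgb_inj.
Qed.

Lemma sqr1_sign_spectrum (q : Zn -> R) : even_fun q -> (forall k, q k ^+ 2 = 1) ->
  exists2 b, size b = M & q =1 sign_spectrum b.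
Proof.
move=> qe q2; exists (mkseq (fun i => q (inZp i) == 1) M); first by rewrite size_mkseq.
move=> k; rewrite /sign_spectrum nth_mkseq ?fold_idx_lt //.
rewrite (even_fold qe k) /sgb; case: eqP => // q1.
by have /eqP := q2 (inZp (fold_idx N k)); rewrite sqrf_eq1 => /orP[]/eqP.
Qed.

Lemma card_OCS : OCS R N #= `I_(2 ^ M).
Proof.
rewrite -size_bitseqs -count_predT; apply: (@card_eq_bitseqs _ _ sign_mx) sign_mx_inj => U.
rewrite (OCSP c0 cM csum); split=> [[q [qe q2 ->]]|[b [_ _ ->]]].
  have [b sb qb] := sqr1_sign_spectrum qe q2.
  by exists b; split=> //; apply: eq_spectral.
exists (sign_spectrum b); split=> //; first exact: sign_spectrum_even.
exact: sign_spectrum_sqr.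
Qed.

Lemma card_OCSN : OCSN R N #= `I_(count all_nz (bitseqs M)).
Proof.
apply: (@card_eq_bitseqs _ _ sign_mx) sign_mx_inj => U; split.
  case=> /(OCSP c0 cM csum)[q [qe q2 ->]].
  have [b sb /(eq_spectral c) ->] := sqr1_sign_spectrum qe q2.
  by move=> /nonzero_spectral/dft_sign_neq0; exists b.
case=> b [_ nz ->]; split; last exact/nonzero_spectral/dft_sign_neq0.
apply/(OCSP c0 cM csum); exists (sign_spectrum b).
by split=> //; [exact: sign_spectrum_even|exact: sign_spectrum_sqr].
Qed.

Lemma sgn_spectrum_sign b : all_nz b ->
  (forall k, 0 < sgn_spectrum c (sign_spectrum b) k) <-> is_ahm b.
Proof.
move=> nz; rewrite /is_ahm nz andTb.
have E (k : Zn) : (0 < sgn_spectrum c (sign_spectrum b) k) =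
    (0 < sign_sum (signs b) (fold_idx N k) * sgb (nth true b (fold_idx N k))).
  rewrite /sgn_spectrum (eq_dft c (sg_dft nz)) -dft_sign -mulrA.
  by rewrite [RHS]pmulr_rgt0.
split=> [pd|/allP pd k].
  apply/allP => j; rewrite mem_iota add0n => jM.
  by have := pd (inZp j); rewrite E /= modn_small ?ltMN // fold_idx_id.
by rewrite E; apply: pd; rewrite mem_iota fold_idx_lt //= ltn_ord.
Qed.

Lemma card_AHM : AHM R N #= `I_(count is_ahm (bitseqs M)).
Proof.
have s0 : Num.sqrt (N%:R : R) != 0 by rewrite gt_eqF // sqrtr_gt0 ltr0n.
apply: (@card_eq_bitseqs _ _ (fun b => Num.sqrt N%:R *: sign_mx b)) => [U|].
  rewrite (AHMP c0 cM csum); split=> [[q [qe q2 nz pd ->]]|[b [_ ahm ->]]].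
    have [b sb qb] := sqr1_sign_spectrum qe q2; exists b.
    have nzb : all_nz b by apply/dft_sign_neq0 => k; rewrite -(eq_dft c qb).
    split=> //; last by congr (_ *: _); apply: eq_spectral.
    apply/(sgn_spectrum_sign nzb) => k; rewrite /sgn_spectrum -qb.
    by rewrite (@eq_dft _ _ c _ (fun j => Num.sg (dft c q j))) ?pd // => j; rewrite (eq_dft c qb).
  have nz : all_nz b by case/andP: ahm.
  exists (sign_spectrum b); split=> //; first exact: sign_spectrum_even.
  - exact: sign_spectrum_sqr.
  - exact/dft_sign_neq0.
  - exact/sgn_spectrum_sign.
move=> b b' sb sb' E; apply: sign_mx_inj => //.
by rewrite -[LHS](scalerK s0) E scalerK.
Qed.

Lemma sgbN x : sgb (~~ x) = - sgb x.
Proof. by case: x; rewrite /sgb /= ?opprK. Qed.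

Lemma sign_sumN b j : size b = M -> sign_sum (map negb b) j = - sign_sum b j.
Proof.
move=> sb; rewrite /sign_sum -sumrN; apply: eq_bigr => k _.
by rewrite (nth_map true) ?sb // sgbN mulNr mulrN.
Qed.

Lemma all_nzN b : size b = M -> all_nz (map negb b) = all_nz b.
Proof. by move=> sb; apply: eq_all => j; rewrite sign_sumN // oppr_eq0. Qed.

(** Negating [b] negates every sum; a zero sum would give [false] on both sides, which [all_nz b]
    excludes. *)
Lemma signsN b : size b = M -> all_nz b -> signs (map negb b) = map negb (signs b).
Proof.
move=> sb /allP nz; rewrite /signs /mkseq -map_comp; apply/eq_in_map => j jM /=.
by rewrite sign_sumN // oppr_gt0 ltNge le_eqVlt eq_sym (negPf (nz _ jM)).
Qed.

Lemma is_ahmN b : size b = M -> is_ahm (map negb b) = is_ahm b.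
Proof.
move=> sb; rewrite /is_ahm all_nzN //; case: (boolP (all_nz b)) => // nz; rewrite !andTb.
apply: eq_in_all => j; rewrite mem_iota /= add0n => jM.
rewrite signsN // sign_sumN ?size_signs // (nth_map true) ?sb //.
by rewrite sgbN mulrNN.
Qed.

(** As q_k is 1 or -1, positivity of T(s)_k q_k says that T(s)_k is nonzero with sign q_k. In this
    form membership is decided by two sign computations, hence by table lookups. *)
Lemma is_ahmE b : size b = M ->
  is_ahm b = [&& all_nz b, all_nz (signs b) & signs (signs b) == b].
Proof.
move=> sb; rewrite /is_ahm; case: (boolP (all_nz b)) => // _; rewrite !andTb.
set s := signs b; apply/allP/andP => [pd|[/allP nz /eqP sE] j jM].
  split.
    apply/allP => j /pd; apply: contraL => /eqP ->; by rewrite mul0r ltxx.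
  apply/eqP/(@eq_from_nth _ true) => [|j]; rewrite size_signs ?sb // => jM.
  have := pd j; rewrite mem_iota add0n jM => /(_ isT).
  rewrite [signs s]/signs nth_mkseq // /sgb; case: (nth true b j).
    by rewrite mulr1.
  by rewrite mulrN1 oppr_gt0 => /ltW; rewrite leNgt => /negPf.
rewrite -sE [signs s]/signs; move: (jM); rewrite mem_iota add0n /= => jM'.
rewrite nth_mkseq // /sgb; move: (nz j jM); move: (sign_sum s j) => x.
case: (ltrgt0P x) => [x0|x0|->]; rewrite ?eqxx // => _; first by rewrite mulr1.
by rewrite mulrN1 oppr_gt0.
Qed.

End SignVectors.

(** * The Chebyshev recurrence as a source of cosines *)

Section Chebyshev.
Variables (R : realType) (x : R).

(* [cheb (2 cos t) k = 2 cos (k t)]. *)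
Fixpoint cheb k : R :=
  if k is (k''.+1 as k').+1 then x * cheb k' - cheb k'' else if k is 1%N then x else 2.

Lemma chebSS k : cheb k.+2 = x * cheb k.+1 - cheb k. Proof. by []. Qed.

(** The product formula for the indices a + b and a - b, with k = a - b so that no natural
    subtraction occurs. *)
Lemma chebM b k : cheb (k + b.*2) + cheb k = cheb (k + b) * cheb b.
Proof.
elim/ltn_ind: b k => -[|[|b]] IH k.
- by rewrite !addn0 /=; ring.
- by rewrite addn2 addn1 chebSS /=; ring.
rewrite (chebSS b) mulrBr.
have := IH b.+1 (ltnSn _) k.+1; have := IH b (leqnSn _) k.+2.
have -> : (k.+2 + b.*2 = k + b.*2.+2)%N by lia.
have -> : (k.+2 + b = k + b.+2)%N by lia.
have -> : (k.+1 + b.+1.*2 = (k + b.*2.+2).+1)%N by lia.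
have -> : (k.+1 + b.+1 = k + b.+2)%N by lia.
rewrite (_ : (k + b.+2.*2 = (k + b.*2.+2).+2)%N); last by lia.
rewrite !chebSS; move: (cheb (k + b.*2.+2).+1) (cheb (k + b.*2.+2)) (cheb (k + b.+2)).
by move: (cheb k.+1) (cheb k) (cheb b.+1) (cheb b) => u v s t p q r; nra.
Qed.

Variable n : nat.
Local Notation N := n.+2.
(** Together these say that x = 2cos(2 pi j / N) with j prime to N: the first two give the period N,
    the third rules out a shorter one. *)
Hypothesis chebN : cheb N = 2.
Hypothesis chebN1 : cheb n.+1 = x.
Hypothesis cheb_neq2 : forall k, (0 < k < N)%N -> cheb k != 2.

Lemma cheb_period k : cheb (k + N) = cheb k.
Proof.
elim/ltn_ind: k => -[|[|k]] IH; first by rewrite add0n chebN.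
  by rewrite add1n chebSS chebN chebN1 /=; ring.
by rewrite !addSn !chebSS -addSn !IH // leqnSn.
Qed.

Lemma cheb_mod k : cheb (k %% N) = cheb k.
Proof.
rewrite {2}(divn_eq k N) addnC; elim: (k %/ N)%N => [|i IH]; first by rewrite addn0.
by rewrite mulSn [(N + _)%N]addnC addnA cheb_period.
Qed.

Let c (a : 'Z_N) := cheb a / 2.

Lemma chebc0 : c 0 = 1. Proof. by rewrite /c divff // pnatr_eq0. Qed.

Lemma chebcM (a b : 'Z_N) : c (a + b) + c (a - b) = 2 * c a * c b.
Proof.
rewrite /c /= /Zp_trunc /= modnDmr !cheb_mod.
have bN : (b < N)%N := ltn_ord b.
(* The class a - b is represented by a + (N - b); the other two indices then become a + b + N and a
   + N, reduced by periodicity. *)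
have := chebM b (a + (N - b)).
rewrite (_ : a + (N - b) + b.*2 = (a + b) + N)%N; last by lia.
rewrite (_ : a + (N - b) + b = a + N)%N; last by lia.
rewrite !cheb_period => E; by rewrite -mulrDl E; field.
Qed.

(** By the product formula 2 c(a) s is the sum of two translates of s, that is 2 s; as c(a) differs
    from 1, s = 0. *)
Lemma chebcsum (a : 'Z_N) : a != 0 -> \sum_k c (a * k) = 0.
Proof.
move=> a0; set s := \sum_k _.
have : 2 * c a * s = 2 * s.
  have -> : 2 * c a * s = \sum_k (c (a * (k + 1)) + c (a * (k - 1))).
    rewrite mulr_sumr; apply: eq_bigr => k _.
    by rewrite mulrDr mulrBr mulr1 chebcM; ring.
  rewrite big_split /= (sum_addZ (fun k => c (a * k))).
  by rewrite (sum_subZ (fun k => c (a * k))) mulr_natl mulr2n.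
move/eqP; rewrite -subr_eq0 -mulrBl mulf_eq0 => /orP[|/eqP //].
rewrite /c mulrC divfK ?pnatr_eq0 // subr_eq0 => /eqP E.
have /eqP : cheb a != 2; last by rewrite E.
by apply: cheb_neq2; rewrite lt0n a0 (ltn_ord a).
Qed.

End Chebyshev.

(** * Integers in the real field, and polynomials in x modulo a monic polynomial *)

(* Locked so that unification never expands large integers in unary. *)
HB.lock Definition zr (R : realType) (z : Z) : R := (int_of_Z z)%:~R.

Section IntegerEmbedding.
Variable R : realType.
Local Notation zr := (@zr R).


Lemma zrD a b : zr (a + b)%ZZ = zr a + zr b.
Proof. by rewrite zr.unlock (rmorphD int_of_Z) rmorphD. Qed.
Lemma zrM a b : zr (a * b)%ZZ = zr a * zr b.
Proof. by rewrite zr.unlock (rmorphM int_of_Z) rmorphM. Qed.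
Lemma zrN a : zr (- a)%ZZ = - zr a.
Proof. by rewrite zr.unlock (rmorphN int_of_Z) rmorphN. Qed.
Lemma zrB a b : zr (a - b)%ZZ = zr a - zr b.
Proof. by rewrite -Z.add_opp_r zrD zrN. Qed.
Lemma zr0 : zr 0%ZZ = 0. Proof. by rewrite zr.unlock. Qed.
Lemma zr1 : zr 1%ZZ = 1. Proof. by rewrite zr.unlock. Qed.
Lemma zr2 : zr 2%ZZ = 2. Proof. by rewrite zr.unlock. Qed.
Lemma le_zr a b : (a <= b)%ZZ -> zr a <= zr b.
Proof. by move=> ab; rewrite zr.unlock ler_int; lia. Qed.
Lemma lt_zr a b : (a < b)%ZZ -> zr a < zr b.
Proof. by move=> ab; rewrite zr.unlock ltr_int; lia. Qed.
Lemma zr_nat k : zr (Z.of_nat k) = k%:R.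
Proof.
elim: k => [|k IH]; first exact: zr0.
by rewrite Nat2Z.inj_succ -Z.add_1_r zrD IH -addn1 natrD zr1.
Qed.
Lemma zr_abs a : zr (Z.abs a) = `|zr a|.
Proof.
case: (Z.abs_spec a) => -[a0 ->]; first by rewrite ger0_norm // -zr0 le_zr.
by rewrite zrN ler0_norm // -zr0 le_zr //; lia.
Qed.

Lemma zr_div a b : (0 < b)%ZZ -> zr (a / b) <= zr a / zr b < zr (a / b) + 1.
Proof.
move=> b0; have zb : 0 < zr b by rewrite -zr0 lt_zr.
rewrite ler_pdivlMr // ltr_pdivrMr // -zr1 -zrD -!zrM; apply/andP; split.
  by apply: le_zr; rewrite Z.mul_comm; apply: Z.mul_div_le.
by apply: lt_zr; rewrite Z.mul_comm; apply: Z.mul_succ_div_gt.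
Qed.

Variable x : R.

Definition heval (p : seq Z) : R := foldr (fun a y => zr a + x * y) 0 p.

Fixpoint zipw (f : Z -> Z -> Z) (s t : seq Z) : seq Z :=
  if s is a :: s' then if t is b :: t' then f a b :: zipw f s' t' else [::] else [::].

Lemma size_zipw f s t : size s = size t -> size (zipw f s t) = size s.
Proof. by elim: s t => [|a s IH] [|b t] //= [/IH ->]. Qed.

Lemma zipw_rcons f s t a : size s = size t -> zipw f (rcons s a) t = zipw f s t.
Proof. by elim: s t => [|b s IH] [|d t] //= [/IH ->]. Qed.

Lemma heval_zipw f (l : R) s t : (forall a b, zr (f a b) = zr a + l * zr b) ->
  size s = size t -> heval (zipw f s t) = heval s + l * heval t.
Proof.
move=> fE; elim: s t => [|a s IH] [|b t] //=; first by rewrite mulr0 addr0.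
by move=> [/IH ->]; rewrite fE; ring.
Qed.

Lemma nth_zipw f (l : R) s t j : (forall a b, zr (f a b) = zr a + l * zr b) ->
  size s = size t ->
  zr (nth 0%ZZ (zipw f s t) j) = zr (nth 0%ZZ s j) + l * zr (nth 0%ZZ t j).
Proof.
move=> fE; elim: s t j => [|a s IH] [|b t] [|j] //=; rewrite ?zr0 ?mulr0 ?addr0 //.
by move=> [/IH].
Qed.

Lemma zrD1 a b : zr (a + b) = zr a + 1 * zr b.
Proof. by rewrite mul1r zrD. Qed.
Lemma zrBN1 a b : zr (a - b) = zr a + -1 * zr b.
Proof. by rewrite mulN1r zrB. Qed.

Lemma heval_rcons p a : heval (rcons p a) = heval p + x ^+ size p * zr a.
Proof.
elim: p => [|b p IH] /=; first by rewrite mulr0 addr0 add0r mul1r.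
by rewrite IH exprS; ring.
Qed.

Lemma heval_nseq0 k : heval (nseq k 0%ZZ) = 0.
Proof. by elim: k => //= k ->; rewrite zr0 mulr0 addr0. Qed.

Lemma heval_eq0 p : all (Z.eqb 0) p -> heval p = 0.
Proof. by elim: p => //= -[] //= p IH /IH ->; rewrite mulr0 addr0 zr0. Qed.

Lemma heval_scale a p : heval [seq (a * z)%ZZ | z <- p] = zr a * heval p.
Proof. by elim: p => [|b p IH] /=; rewrite ?mulr0 // IH zrM; ring. Qed.

(* [psi] lists the lower coefficients of a monic polynomial of degree [size psi]. *)
Definition mulx (psi p : seq Z) : seq Z :=
  let l := last 0%ZZ p in zipw (fun a b => (a - l * b)%ZZ) (0%ZZ :: p) psi.

Lemma size_mulx psi p : size p = size psi -> size (mulx psi p) = size psi.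
Proof.
case/lastP: p => [|p l] E; first by rewrite /mulx -E; case: psi E.
have Ep : size (0%ZZ :: p) = size psi by rewrite -E size_rcons.
by rewrite /mulx -rcons_cons zipw_rcons // size_zipw.
Qed.

(** Multiplication by x shifts the coefficients; the overflowing leading term l x^d is replaced by
    -l times the lower part of the monic polynomial. [zipw] drops the overflow because [psi] is
    shorter by one. *)
Lemma heval_mulx psi p : heval (rcons psi 1%ZZ) = 0 -> size p = size psi ->
  heval (mulx psi p) = x * heval p.
Proof.
rewrite heval_rcons zr1 mulr1 => root_x.
case/lastP: p => [|p l] E; first by case: psi E {root_x} => //= _; rewrite mulr0.
have Ep : size (0%ZZ :: p) = size psi by rewrite -E size_rcons.
rewrite /mulx last_rcons -rcons_cons zipw_rcons //.
rewrite (@heval_zipw _ (- zr l)) //; last by move=> a b; rewrite zrB zrM mulNr.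
rewrite heval_rcons (_ : size p = (size psi).-1) -?Ep //= zr0 add0r.
move: root_x; rewrite -Ep /= exprS; move: (x ^+ size p) (heval psi) => y h; nra.
Qed.

End IntegerEmbedding.

(** * Table of the values 2cos(2 pi k / N), exact and in fixed point *)

Record entry := Entry { exact_val : seq Z; approx : Z; err : Z }.

Definition scale := Eval compute in (2 ^ 60)%ZZ.

(** The error bound uses |x| <= (|a1| + 1) / scale for the error inherited from [v], and an error of
    one unit in [a1] for the term with [approx v]. The constant 2 pays for the two floor divisions,
    of the product and of the bound itself. *)
Definition cheb_step (psi : seq Z) (a1 : Z) (u v : entry) : entry :=
  Entry (zipw Z.sub (mulx psi (exact_val v)) (exact_val u))
    (a1 * approx v / scale - approx u)%ZZ
    (((Z.abs a1 + 1) * err v + Z.abs (approx v)) / scale + 2 + err u)%ZZ.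

Fixpoint cheb_table psi a1 k u v : seq entry :=
  if k is k'.+1 then u :: cheb_table psi a1 k' v (cheb_step psi a1 u v) else [::].

Definition constp (psi : seq Z) a : seq Z := a :: nseq (size psi).-1 0%ZZ.

Definition table (psi : seq Z) (a1 : Z) N : seq entry :=
  cheb_table psi a1 N.+1 (Entry (constp psi 2%ZZ) (2 * scale)%ZZ 0%ZZ)
    (Entry (mulx psi (constp psi 1%ZZ)) a1 1%ZZ).

(* The second component is [scale ^ size p]; the first one is that power times
   the value of [p] at [a / scale]. *)
Fixpoint scaled_val (a : Z) (p : seq Z) : Z * Z :=
  if p is b :: p' then
    let: (h, s) := scaled_val a p' in (b * (s * scale) + a * h, s * scale)%ZZ
  else (0, 1)%ZZ.

Definition dummy := Entry [::] 0%ZZ 0%ZZ.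

(** The sign change around [a1] locates the root x; the two equalities of residues give the period
    N; the bound strictly below 2 excludes shorter periods; the last bound is the precision required
    by [rounded]. *)
Definition check_table psi a1 N :=
  let t := table psi a1 N in
  let e k := nth dummy t k in
  [&& (0 < size psi)%N,
      ((scaled_val (a1 - 1) (rcons psi 1)).1 <=? 0)%ZZ,
      (0 <=? (scaled_val (a1 + 1) (rcons psi 1)).1)%ZZ,
      exact_val (e N) == exact_val (e 0%N),
      exact_val (e N.-1) == exact_val (e 1%N),
      all (fun k => approx (e k) + err (e k) <? 2 * scale)%ZZ (iota 1 N.-1) &
      all (fun k => err (e k) <=? 2 ^ 44)%ZZ (iota 0 N)].

(** * Existence of the root and soundness of the table *)

Section TableSoundness.
Variable R : realType.
Local Notation zr := (@zr R).

Definition approximates (psi : seq Z) (x y : R) e :=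
  [/\ size (exact_val e) = size psi, heval x (exact_val e) = y &
      `|zr scale * y - zr (approx e)| <= zr (err e)].

Lemma scale_gt0 : 0 < zr scale. Proof. by rewrite -(zr0 R) lt_zr. Qed.

Lemma scaled_valE a p :
  zr (scaled_val a p).2 = zr scale ^+ size p /\
  zr (scaled_val a p).1 = zr scale ^+ size p * heval (zr a / zr scale) p.
Proof.
elim: p => [|b p] /=; first by rewrite mulr0 zr0 zr1.
case: (scaled_val a p) => h s /= [Es Eh].
rewrite zrD !zrM Es Eh exprS; split; first exact: mulrC.
move: (zr scale) scale_gt0 (zr a) (zr b) => D D0 A B.
by field; rewrite gt_eqF.
Qed.

Lemma scaled_val_le0 a p : ((scaled_val a p).1 <= 0)%ZZ ->
  heval (zr a / zr scale) p <= 0.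
Proof.
move=> /(le_zr R); rewrite (scaled_valE a p).2 zr0.
by rewrite pmulr_rle0 // exprn_gt0 // scale_gt0.
Qed.

Lemma scaled_val_ge0 a p : (0 <= (scaled_val a p).1)%ZZ ->
  0 <= heval (zr a / zr scale) p.
Proof.
move=> /(le_zr R); rewrite (scaled_valE a p).2 zr0.
by rewrite pmulr_rge0 // exprn_gt0 // scale_gt0.
Qed.

Lemma heval_horner (x : R) p : heval x p = (Poly (map zr p)).[x].
Proof. by rewrite horner_Poly; elim: p => //= a p ->; rewrite addrC mulrC. Qed.

(** Intermediate value theorem between (a1 - 1) / scale and (a1 + 1) / scale. *)
Lemma approx_root p a1 :
  ((scaled_val (a1 - 1) p).1 <= 0)%ZZ -> (0 <= (scaled_val (a1 + 1) p).1)%ZZ ->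
  exists2 x : R, heval x p = 0 & `|zr scale * x - zr a1| <= 1.
Proof.
move=> /scaled_val_le0 lo /scaled_val_ge0 hi.
have le : zr (a1 - 1) / zr scale <= zr (a1 + 1) / zr scale.
  by rewrite ler_pM2r ?invr_gt0 ?scale_gt0 // le_zr; lia.
have [|x] := poly_ivt le (p := Poly (map zr p)); first by rewrite -!heval_horner lo.
rewrite ler_pdivrMr ?ler_pdivlMr ?scale_gt0 // => /andP[].
rewrite zrB zrD zr1 /root -heval_horner => lex gex /eqP px; exists x => //.
by rewrite ler_distl mulrC lex gex.
Qed.

Lemma step_error (D x y z A V Y f ev eu g : R) : 0 < D ->
  `|D * x - A| <= 1 -> `|D * z - V| <= ev -> `|D * y - Y| <= eu ->
  f <= A * V / D < f + 1 -> ((`|A| + 1) * ev + `|V|) / D < g + 1 ->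
  `|D * (x * z - y) - (f - Y)| <= g + 2 + eu.
Proof.
move=> D0 ax av au /andP[f_le f_gt] g_gt.
(* Four sources of error: inexact z, inexact x, the floor of the product, inexact y. The first two
   together stay below g + 1, the third is at most 1. *)
have split_err : D * (x * z - y) - (f - Y) =
  x * (D * z - V) + V * (D * x - A) / D + (A * V / D - f) - (D * y - Y).
  by field; rewrite gt_eqF.
have Dx : D * `|x| <= `|A| + 1.
  rewrite -{1}(ger0_norm (ltW D0)) -normrM -[D * x](subrK A) addrC.
  by apply: le_trans (ler_normD _ _) _; rewrite lerD2l.
have e1 : `|x * (D * z - V)| <= (`|A| + 1) * ev / D.
  rewrite normrM ler_pdivlMr // mulrAC [_ * D]mulrC.
  by apply: ler_pM => //; rewrite mulr_ge0 ?normr_ge0 // ltW.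
have e2 : `|V * (D * x - A) / D| <= `|V| / D.
  rewrite !normrM normfV (ger0_norm (ltW D0)) ler_pM2r ?invr_gt0 //.
  by rewrite ler_piMr.
have e3 : `|A * V / D - f| <= 1 by rewrite ger0_norm; lra.
rewrite split_err; apply: le_trans (ler_normB _ _) _.
have := ler_normD (x * (D * z - V) + V * (D * x - A) / D) (A * V / D - f).
have := ler_normD (x * (D * z - V)) (V * (D * x - A) / D).
rewrite mulrDl in g_gt; lra.
Qed.

Variables (psi : seq Z) (a1 : Z) (x : R).
Hypothesis psi_gt0 : (0 < size psi)%N.
Hypothesis root_x : heval x (rcons psi 1%ZZ) = 0.
Hypothesis approx_x : `|zr scale * x - zr a1| <= 1.
Local Notation entry_for := (approximates psi x).

Lemma size_constp a : size (constp psi a) = size psi.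
Proof. by rewrite /= size_nseq prednK. Qed.

Lemma heval_constp a : heval x (constp psi a) = zr a.
Proof. by rewrite /= heval_nseq0 mulr0 addr0. Qed.

Lemma entry_for0 : entry_for 2 (Entry (constp psi 2%ZZ) (2 * scale)%ZZ 0%ZZ).
Proof.
split; rewrite ?size_constp ?heval_constp ?zr2 //.
by rewrite /approx /err zrM zr2 mulrC subrr normr0 zr0.
Qed.

Lemma entry_for1 : entry_for x (Entry (mulx psi (constp psi 1%ZZ)) a1 1%ZZ).
Proof.
split; rewrite ?size_mulx ?size_constp //.
  by rewrite heval_mulx ?size_constp // heval_constp zr1 mulr1.
by rewrite /= zr1.
Qed.

Lemma entry_for_step u v y z : entry_for y u -> entry_for z v ->
  entry_for (x * z - y) (cheb_step psi a1 u v).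
Proof.
move=> [su hu au] [sv hv av]; split=> /=.
- by rewrite size_zipw ?size_mulx.
- rewrite (@heval_zipw _ _ _ (-1)) ?size_mulx //; last exact: zrBN1.
  by rewrite heval_mulx // hu hv mulN1r.
have S0 := scale_gt0.
have := zr_div R (a1 * approx v) (erefl : (0 < scale)%ZZ).
have := zr_div R ((Z.abs a1 + 1) * err v + Z.abs (approx v)) (erefl : (0 < scale)%ZZ).
set f := (_ / scale)%ZZ; set g := (_ / scale)%ZZ.
rewrite !(zrD, zrB, zrM, zr_abs) zr1 zr2 => /andP[_ g_gt] f_div.
exact: (step_error S0 approx_x av au f_div g_gt).
Qed.

Lemma entry_for_table k i u v :
  entry_for (cheb x i) u -> entry_for (cheb x i.+1) v ->
  forall j, (j < k)%N -> entry_for (cheb x (i + j)) (nth dummy (cheb_table psi a1 k u v) j).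
Proof.
elim: k i u v => // k IH i u v eu ev [|j] jk /=; first by rewrite addn0.
by rewrite addnS -addSn; apply: IH => //; apply: entry_for_step.
Qed.

Lemma table_entry N k : (k <= N)%N ->
  entry_for (cheb x k) (nth dummy (table psi a1 N) k).
Proof.
by move=> kN; apply: (@entry_for_table _ 0) => //; [exact: entry_for0|exact: entry_for1].
Qed.

End TableSoundness.

(** * The computation: a binary trie of sign patterns *)

(* [Unknown] is an inconclusive sign test; [check_counts] verifies that it never occurs. *)
Inductive leaf := Nonzero of bitseq | HasZero | Unknown.
(** Vectors with a common prefix share their partial sums, and each leaf stores its sign pattern, so
    iterating q -> sgn T(q) once more costs one lookup. *)
Inductive trie := Leaf of leaf | Node of trie & trie.

Definition leaf_cons x l := if l is Nonzero s then Nonzero (x :: s) else l.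

Fixpoint signed_sum (rows : seq (seq Z)) (b : bitseq) (acc : seq Z) : seq Z :=
  if rows is r :: rows' then if b is x :: b' then
    signed_sum rows' b' (zipw (if x then Z.add else Z.sub) acc r)
  else acc else acc.

(** An approximate sum outside [-e, e] has the sign of the true one; only inside this interval is
    the exact residue computed, and only a zero residue is then conclusive. *)
Fixpoint eval_leaf (e : Z) (zero acc : seq Z) (rows : seq (seq (seq Z))) (b : bitseq) : leaf :=
  if acc is a :: acc' then if rows is r :: rows' then
    if (e <? a)%ZZ then leaf_cons true (eval_leaf e zero acc' rows' b)
    else if (a <? - e)%ZZ then leaf_cons false (eval_leaf e zero acc' rows' b)
    else if all (Z.eqb 0) (signed_sum r b zero) then HasZero else Unknown
  else Nonzero [::] else Nonzero [::].

(* [rb] is the reversed path from the root. *)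
Fixpoint build e zero rows (cols : seq (seq Z)) (acc : seq Z) (rb : bitseq) : trie :=
  if cols is c :: cols' then
    Node (build e zero rows cols' (zipw Z.add acc c) (true :: rb))
         (build e zero rows cols' (zipw Z.sub acc c) (false :: rb))
  else Leaf (eval_leaf e zero acc rows (rev rb)).

Fixpoint lookup t (b : bitseq) : leaf :=
  match t, b with
  | Leaf l, _ => l
  | Node t1 t2, x :: b' => lookup (if x then t1 else t2) b'
  | Node _ _, [::] => Unknown
  end.

Fixpoint count_leaves (P : leaf -> bitseq -> bool) t (rb : bitseq) : N :=
  match t with
  | Leaf l => if P l (rev rb) then 1%num else 0%num
  | Node t1 t2 =>
      N.add (count_leaves P t1 (true :: rb)) (count_leaves P t2 (false :: rb))
  end.

(** Nested conditionals stop at the first difference under call-by-value evaluation. *)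
Fixpoint eq_bits (s t : bitseq) : bool :=
  match s, t with
  | [::], [::] => true
  | x :: s', y :: t' => if (if x then y else ~~ y) then eq_bits s' t' else false
  | _, _ => false
  end.

Definition is_unknown (l : leaf) (_ : bitseq) := if l is Unknown then true else false.
Definition is_nonzero (l : leaf) (_ : bitseq) := if l is Nonzero _ then true else false.
(** Paths in the trie omit the leading [true]. A pattern starting with [false] is looked up through
    its negation, and the answer is compared with the negated vector. *)
Definition is_fixed t (l : leaf) (b : bitseq) :=
  if l is Nonzero (x :: s) then
    if lookup t (if x then s else map negb s) is Nonzero b'
    then eq_bits b' (if x then b else map negb b) else false
  else false.

Lemma eq_bitsE s t : eq_bits s t = (s == t).
Proof. by elim: s t => [|x s IH] [|y t] //=; rewrite eqseq_cons -IH; case: x y => -[]. Qed.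

Definition zmult N k := Z.of_nat (fold_mult N k).
(* Sixteen fractional bits remain, with error at most 2; over all [N] the least
   nonzero sum is about 0.002, above the resulting uncertainty [2 N / 2 ^ 16]. *)
Definition rounded t : seq Z := [seq (approx e / 2 ^ 44)%ZZ | e <- t].
(** Grouped by sign index, so that descending one level adds or subtracts a single vector. *)
Definition col_of N (aps : seq Z) k : seq Z :=
  [seq (zmult N k * nth 0 aps ((j * k) %% N))%ZZ | j <- iota 0 N./2.+1].
(** Grouped by sum index, since an exact value is wanted for one [j] at a time. *)
Definition row_of N (exs : seq (seq Z)) j : seq (seq Z) :=
  [seq [seq (zmult N k * z)%ZZ | z <- nth [::] exs ((j * k) %% N)] | k <- iota 0 N./2.+1].

(* By the symmetry [b -> map negb b], only the sign vectors starting with [true]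
   are explored. *)
Definition sign_trie (psi : seq Z) (t : seq entry) N : trie :=
  let aps := rounded t in
  let exs := map exact_val t in
  build (Z.of_nat N.*2) (nseq (size psi) 0%ZZ)
    [seq row_of N exs j | j <- iota 0 N./2.+1]
    [seq col_of N aps k | k <- iota 1 N./2] (col_of N aps 0) [:: true].

(* Lower coefficients of the minimal polynomial of [2 cos (2 pi / N)], and that
   number times [2 ^ 60], rounded. *)
Definition min_poly_data (N : nat) : seq Z * Z :=
  match N with
  | 2 => ([:: 2], -2305843009213693952)%ZZ
  | 3 => ([:: 1], -1152921504606846976)%ZZ
  | 4 => ([:: 0], 0)%ZZ
  | 5 => ([:: -1; 1], 712544676207699905)%ZZ
  | 6 => ([:: -1], 1152921504606846976)%ZZ
  | 7 => ([:: -1; -2; 1], 1437669600931991917)%ZZ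
  | 8 => ([:: -2; 0], 1630477228166597777)%ZZ
  | 9 => ([:: 1; -3; 0], 1766378223912892722)%ZZ
  | 10 => ([:: -1; -1], 1865466180814546881)%ZZ
  | 11 => ([:: 1; 3; -3; -4; 1], 1939798577655101867)%ZZ
  | 12 => ([:: -3; 0], 1996918623117814388)%ZZ
  | 13 => ([:: -1; 3; 6; -4; -5; 1], 2041722586718595294)%ZZ
  | 14 => ([:: 1; -2; -1], 2077492765571969234)%ZZ
  | 15 => ([:: 1; 4; -4; -1], 2106492407104116035)%ZZ
  | 16 => ([:: 2; 0; -4; 0], 2130321161396766249)%ZZ
  | 17 => ([:: 1; -4; -10; 10; 15; -6; -7; 1], 2150134571457941742)%ZZ
  | 18 => ([:: -1; -3; 0], 2166783660448881563)%ZZ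
  | 19 => ([:: 1; 5; -10; -20; 15; 21; -7; -8; 1], 2180906074769187170)%ZZ
  | 20 => ([:: 5; 0; -5; 0], 2192987019466309470)%ZZ
  | 21 => ([:: 1; -8; 8; 6; -6; -1], 2203400874016687487)%ZZ
  | 22 => ([:: -1; 3; 3; -4; -1], 2212440165598648113)%ZZ
  | 23 => ([:: -1; -6; 15; 35; -35; -56; 28; 36; -9; -10; 1], 2220336095481936757)%ZZ
  | 24 => ([:: 1; 0; -4; 0], 2227273313967609029)%ZZ
  | 25 => ([:: -1; 5; 25; -5; -50; 1; 35; 0; -10; 0], 2233400710930554980)%ZZ
  | 26 => ([:: -1; -3; 6; 4; -5; -1], 2238839402065100835)%ZZ
  | 27 => ([:: 1; 9; 0; -30; 0; 27; 0; -9; 0], 2243688712477730379)%ZZ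
  | 28 => ([:: -7; 0; 14; 0; -7; 0], 2248030710791760100)%ZZ
  | 29 => ([:: -1; 7; 28; -56; -126; 126; 210; -120; -165; 55; 66; -12; -13; 1], 2251933681038496315)%ZZ
  | 30 => ([:: 1; -4; -4; 1], 2255454807131193227)%ZZ
  | _ => ([::], 0%ZZ)
  end.

Definition check_counts N : bool :=
  let: (psi, a1) := min_poly_data N in
  let t := table psi a1 N in
  let tr := sign_trie psi t N in
  let: (ocs, ocsn, ahm) := count_table N in
  [&& check_table psi a1 N,
      N.eqb (count_leaves is_unknown tr [:: true]) 0,
      N.eqb (N.of_nat ocs) (2 ^ N.of_nat N./2.+1),
      N.eqb (N.of_nat ocsn) (N.double (count_leaves is_nonzero tr [:: true])) &
      N.eqb (N.of_nat ahm) (N.double (count_leaves (is_fixed tr) tr [:: true]))].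

Lemma all_check_counts : all check_counts (iota 2 29).
(* The whole enumeration is a single conversion, left to the kernel at [Qed] so that it runs
   once. *)
Proof. by vm_cast_no_check (erefl true). Qed.

(** * Soundness of the trie computation *)

Lemma lookup_build e zero rows cols acc rb b : size b = size cols ->
  lookup (build e zero rows cols acc rb) b =
  eval_leaf e zero (signed_sum cols b acc) rows (rev rb ++ b).
Proof.
elim: cols acc rb b => [|c cols IH] acc rb [|x b] //=; first by rewrite cats0.
by move=> [sb]; case: x; rewrite IH // rev_cons cat_rcons.
Qed.

Lemma count_build P e zero rows cols acc rb :
  N.to_nat (count_leaves P (build e zero rows cols acc rb) rb) =
  count (fun b => P (eval_leaf e zero (signed_sum cols b acc) rows (rev rb ++ b))
                    (rev rb ++ b)) (bitseqs (size cols)).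
Proof.
elim: cols acc rb => [|c cols IH] acc rb /=.
  by rewrite cats0 addn0; case: (P _ _).
rewrite N2Nat.inj_add !IH count_cat !count_map; congr addn; apply: eq_count => b /=;
  by rewrite rev_cons cat_rcons.
Qed.

Lemma is_fixed_cons t x s b : is_fixed t (Nonzero (x :: s)) b =
  if lookup t (if x then s else map negb s) is Nonzero b'
  then eq_bits b' (if x then b else map negb b) else false.
Proof. by []. Qed.

Section TrieSoundness.
Variable R : realType.
Local Notation zr := (@zr R).
Local Notation sgb := (@sgb R).

(** Stated for any linear functional [L]: a coordinate handles the approximate sums, evaluation at x
    the exact ones. *)
Lemma signed_sum_linear (L : seq Z -> R) d :
  (forall f l s t, (forall a b, zr (f a b) = zr a + l * zr b) ->
     size s = d -> size t = d -> L (zipw f s t) = L s + l * L t) ->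
  forall rows b acc, size rows = size b -> all (fun r => size r == d) rows ->
  size acc = d ->
  size (signed_sum rows b acc) = d /\
  L (signed_sum rows b acc) =
    L acc + \sum_(k < size rows) sgb (nth true b k) * L (nth [::] rows k).
Proof.
move=> Llin; elim=> [|r rows IH] [|y b] acc //=; first by rewrite big_ord0 addr0.
move=> [sb] /andP[/eqP sr srows] sacc.
set f := if y then Z.add else Z.sub.
have fE a a' : zr (f a a') = zr a + sgb y * zr a'.
  by rewrite /f; case: y {f}; [exact: zrD1|exact: zrBN1].
have [|-> ->] := IH b (zipw f acc r) sb srows; first by rewrite size_zipw ?sacc ?sr.
by rewrite (Llin _ _ _ _ fE) // big_ord_recl /= addrA.
Qed.

Lemma eval_leafP e zero accs rows b (vals : seq R) (D : R) : 0 < D ->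
  size accs = size vals -> size rows = size vals ->
  (forall j, (j < size vals)%N -> `|D * nth 0 vals j - zr (nth 0%ZZ accs j)| <= zr e) ->
  (forall j, (j < size vals)%N ->
    all (Z.eqb 0) (signed_sum (nth [::] rows j) b zero) -> nth 0 vals j = 0) ->
  match eval_leaf e zero accs rows b with
  | Nonzero s => s = [seq 0 < v | v <- vals] /\ all (fun v => v != 0) vals
  | HasZero => ~~ all (fun v => v != 0) vals
  | Unknown => True
  end.
Proof.
move=> D0; elim: accs rows vals => [|a accs IH] [|r rows] [|v vals] //= [sa] [sr] close exact0.
have := IH rows vals sa sr (fun j => close j.+1) (fun j => exact0 j.+1).
have := close 0%N isT; rewrite /= ler_distl => /andP[lo hi].
case: (Z.ltb_spec e a) => [ea|_].
  have v0 : 0 < v by rewrite -(pmulr_rgt0 _ D0); have := lt_zr R ea; lra.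
  case: (eval_leaf _ _ _ _ _) => //= [s [-> ->]|/negPf ->]; last by rewrite andbF.
  by rewrite v0 gt_eqF.
case: (Z.ltb_spec a (- e)) => [ea|_].
  have v0 : v < 0 by rewrite -(pmulr_rlt0 _ D0); have := lt_zr R ea; rewrite zrN; lra.
  case: (eval_leaf _ _ _ _ _) => //= [s [-> ->]|/negPf ->]; last by rewrite andbF.
  by rewrite ltNge (ltW v0) lt_eqF.
by case: ifP => //= z _; have /= -> := exact0 0%N isT z; rewrite eqxx.
Qed.

Section FixedOrder.
Variables (psi : seq Z) (a1 : Z) (n : nat) (x : R).
Local Notation N := n.+2.
Local Notation m := (N./2).
Local Notation w := (cheb x).
Local Notation t := (table psi a1 N).
Local Notation all_nz := (@all_nz R n w).
Local Notation signs := (@signs R n w).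
Hypothesis table_ok : forall k, (k < N)%N -> approximates psi x (w k) (nth dummy t k).
Hypothesis err_ok : forall k, (k < N)%N -> (err (nth dummy t k) <= 2 ^ 44)%ZZ.

Lemma size_table : size t = N.+1.
Proof.
rewrite /table; move: N.+1 (Entry _ _ _) (Entry _ _ _) => k.
by elim: k => //= k IH u v; rewrite IH.
Qed.

(** The table error, at most 2^44, contributes at most 1 after division by 2^44, and the floor at
    most 1 more. *)
Lemma rounded_ok k : (k < N)%N ->
  `|zr (2 ^ 16) * w k - zr (nth 0%ZZ (rounded t) k)| <= 2.
Proof.
move=> kN; rewrite (nth_map dummy) ?size_table ?ltnS 1?ltnW //.
have [_ _] := table_ok kN; set e := nth _ _ _ => close.
have := zr_div R (approx e) (erefl : (0 < 2 ^ 44)%ZZ).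
have := le_zr R (err_ok kN); rewrite -/e.
have d0 : 0 < zr (2 ^ 44) by rewrite -(zr0 R); apply: lt_zr.
have := close; rewrite (_ : scale = 2 ^ 16 * 2 ^ 44)%ZZ // zrM.
move: (zr (2 ^ 44)) d0 (zr (2 ^ 16)) (zr (approx e / 2 ^ 44)) (zr (approx e)) (zr (err e)) (w k).
move=> d d0 D f A E y close1 Ed /andP[f_le f_gt].
have : `|D * y - A / d| <= 1.
  have -> : D * y - A / d = (D * d * y - A) / d by field; rewrite gt_eqF.
  by rewrite normrM normfV (ger0_norm (ltW d0)) ler_pdivrMr // mul1r (le_trans close1).
by rewrite !ler_distl => /andP[? ?]; apply/andP; split; lra.
Qed.

Lemma sum_fold_mult : \sum_(k < m.+1) (fold_mult N k)%:R = N%:R :> R.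
Proof.
have := sum_fold n (fun=> 1 : R); rewrite sumr_const card_ord => ->.
by apply: eq_bigr => k _; rewrite mulr1.
Qed.

Local Notation cols := [seq col_of N (rounded t) k | k <- iota 1 m].
Local Notation exs := (map exact_val t).
Local Notation zero := (nseq (size psi) 0%ZZ).
Local Notation leaf_at b := (eval_leaf (Z.of_nat N.*2) zero
  (signed_sum cols b (col_of N (rounded t) 0))
  [seq row_of N exs j | j <- iota 0 m.+1] (true :: b)).

Lemma size_col k : size (col_of N (rounded t) k) = m.+1.
Proof. by rewrite size_map size_iota. Qed.

(** Each rounded value is off by at most 2 and the multiplicities add up to N, hence the threshold 2
    N. *)
Lemma acc_close b j : size b = m -> (j < m.+1)%N ->
  `|zr (2 ^ 16) * sign_sum n w (true :: b) j -
    zr (nth 0%ZZ (signed_sum cols b (col_of N (rounded t) 0)) j)| <= zr (Z.of_nat N.*2).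
Proof.
move=> sb jM.
have colE k : zr (nth 0%ZZ (col_of N (rounded t) k) j) =
    (fold_mult N k)%:R * zr (nth 0%ZZ (rounded t) ((j * k) %% N)).
  by rewrite (nth_map 0%N) ?size_iota // nth_iota // zrM zr_nat.
have [||||_ ->] := @signed_sum_linear (fun s => zr (nth 0%ZZ s j)) m.+1 _ cols b
    (col_of N (rounded t) 0).
- by move=> f l s u fE ss su; apply: nth_zipw; rewrite // ss.
- by rewrite size_map size_iota sb.
- by apply/allP => _ /mapP[k _ ->]; rewrite size_col.
- exact: size_col.
(* The initial accumulator is column 0, carrying the sign 1 of the leading [true]. *)
have -> : zr (nth 0%ZZ (col_of N (rounded t) 0) j) + \sum_(k < size cols)
      sgb (nth true b k) * zr (nth 0%ZZ (nth [::] cols k) j) =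
   \sum_(k < m.+1) sgb (nth true (true :: b) k) *
      zr (nth 0%ZZ (col_of N (rounded t) k) j).
  rewrite [RHS]big_ord_recl [size cols](_ : _ = m) ?size_map ?size_iota //; congr (_ + _).
    exact: (esym (mul1r _)).
  by apply: eq_bigr => k _; rewrite (nth_map 0%N) ?size_iota // nth_iota.
rewrite /sign_sum mulr_sumr -sumrB.
apply: le_trans (ler_norm_sum _ _ _) _.
rewrite zr_nat -muln2 natrM -sum_fold_mult mulr_suml; apply: ler_sum => k _.
rewrite colE; set r := (_ %% N)%N; set s := sgb _; set c := _%:R.
have -> : zr (2 ^ 16) * (c * (s * w r)) - s * (c * zr (nth 0%ZZ (rounded t) r)) =
    c * (s * (zr (2 ^ 16) * w r - zr (nth 0%ZZ (rounded t) r))) by ring.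
rewrite !normrM normr_sgb mul1r ger0_norm ?ler0n // ler_wpM2l ?ler0n //.
by apply: rounded_ok; rewrite ltn_mod.
Qed.

Lemma row_exact b j : size b = m -> (j < m.+1)%N ->
  all (Z.eqb 0) (signed_sum (row_of N exs j) (true :: b) zero) ->
  sign_sum n w (true :: b) j = 0.
Proof.
move=> sb jM /(heval_eq0 x) <-.
have exsP i : (i < N)%N -> size (nth [::] exs i) = size psi /\
    heval x (nth [::] exs i) = w i.
  move=> iN; rewrite (nth_map dummy) ?size_table ?ltnS 1?ltnW //.
  by case: (table_ok iN).
have [||||_ ->] := @signed_sum_linear (heval x) (size psi) _ (row_of N exs j) (true :: b) zero.
- by move=> f l s u fE ss su; apply: heval_zipw; rewrite // ss.
- by rewrite size_map size_iota /= sb.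
- apply/allP => _ /mapP[k _ ->]; rewrite size_map.
  by rewrite (exsP _ _).1 // ltn_mod.
- by rewrite size_nseq.
rewrite heval_nseq0 add0r size_map size_iota /sign_sum; apply: eq_bigr => k _.
rewrite (nth_map 0%N) ?size_iota // nth_iota // heval_scale (exsP _ _).2 ?ltn_mod //.
by rewrite zr_nat mulrCA.
Qed.

Lemma leaf_atP b : size b = m ->
  match leaf_at b with
  | Nonzero s => s = signs (true :: b) /\ all_nz (true :: b)
  | HasZero => ~~ all_nz (true :: b)
  | Unknown => True
  end.
Proof.
move=> sb; set vals := [seq sign_sum n w (true :: b) j | j <- iota 0 m.+1].
have sv : size vals = m.+1 by rewrite size_map size_iota.
have nthv j : (j < m.+1)%N -> nth 0 vals j = sign_sum n w (true :: b) j.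
  by move=> jM; rewrite (nth_map 0%N) ?size_iota // nth_iota.
have -> : all_nz (true :: b) = all (fun v => v != 0) vals by rewrite all_map.
have -> : signs (true :: b) = [seq 0 < v | v <- vals] by rewrite /signs /mkseq -map_comp.
have D0 : 0 < zr (2 ^ 16) by rewrite -(zr0 R); apply: lt_zr.
apply: (eval_leafP D0); rewrite ?sv ?size_map ?size_iota //.
(* Coordinate 0 is an arbitrary choice of functional; the size component is what is extracted. *)
- have [||||-> //] := @signed_sum_linear (fun s => zr (nth 0%ZZ s 0)) m.+1 _ cols b
      (col_of N (rounded t) 0).
  + by move=> f l s u fE ss su; apply: nth_zipw; rewrite // ss.
  + by rewrite size_map size_iota sb.
  + by apply/allP => _ /mapP[k _ ->]; rewrite size_col.
  + exact: size_col.
- by move=> j jM; rewrite nthv // acc_close.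
move=> j jM; rewrite nthv // (nth_map 0%N) ?size_iota // nth_iota //.
exact: row_exact.
Qed.

Local Notation tr := (sign_trie psi t N).

Lemma lookup_sign_trie b : size b = m -> lookup tr b = leaf_at b.
Proof. by move=> sb; rewrite lookup_build // size_map size_iota. Qed.

Lemma count_sign_trie P : N.to_nat (count_leaves P tr [:: true]) =
  count (fun b => P (leaf_at b) (true :: b)) (bitseqs m).
Proof. by rewrite count_build size_map size_iota. Qed.

Hypothesis no_unknown : N.to_nat (count_leaves is_unknown tr [:: true]) = 0%N.

(** A zero count of [Unknown] leaves excludes them at every vector, so each leaf determines [all_nz]
    and the signs. *)
Lemma leaf_at_known b : size b = m ->
  leaf_at b = if all_nz (true :: b) then Nonzero (signs (true :: b)) else HasZero.
Proof.
move=> sb; have := leaf_atP sb.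
have : ~~ is_unknown (leaf_at b) (true :: b).
  apply: contraL isT => unk; move: no_unknown; rewrite count_sign_trie => /eqP.
  rewrite -leqn0 leqNgt -has_count => /hasPn/(_ b).
  by rewrite mem_bitseqs sb eqxx unk => /(_ isT).
by case: (leaf_at b) => //= [s _ [-> ->]|_ /negPf ->].
Qed.

Lemma count_all_nz : count all_nz (bitseqs m.+1) =
  (N.to_nat (count_leaves is_nonzero tr [:: true])).*2.
Proof.
rewrite count_bitseqs_double; last by move=> b sb; apply: all_nzN.
rewrite count_sign_trie; congr _.*2; apply: eq_in_count => b.
rewrite mem_bitseqs => /eqP sb /=; rewrite leaf_at_known //.
by case: (all_nz _).
Qed.

Lemma map_negbK : involutive (map negb).
Proof. by move=> s; rewrite -map_comp map_id_in // => y _ /=; rewrite negbK. Qed.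

Lemma count_is_ahm : count (@is_ahm R n w) (bitseqs m.+1) =
  (N.to_nat (count_leaves (is_fixed tr) tr [:: true])).*2.
Proof.
rewrite count_bitseqs_double; last by move=> b sb; apply: is_ahmN.
rewrite count_sign_trie; congr _.*2; apply: eq_in_count => b.
rewrite mem_bitseqs => /eqP sb; set q := true :: b.
have sq : size q = m.+1 by congr _.+1.
rewrite -[LHS]/(is_ahm n w q) is_ahmE // leaf_at_known // -/q.
case: ifP => // nz; have := size_signs n w q.
case Es : (signs q) => [|y s] // [ss]; rewrite is_fixed_cons.
case: y Es => Es; rewrite lookup_sign_trie ?size_map // leaf_at_known ?size_map // -Es.
  by case: ifP => // _; rewrite eq_bitsE.
(* Here the leading sign is negative, and the trie is entered at the opposite pattern; since [signs]
   is odd, the test compares the two negated vectors. *)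
have -> : true :: map negb s = map negb (signs q) by rewrite Es.
rewrite all_nzN ?size_signs //; case: ifP => // nz'.
by rewrite signsN ?size_signs // eq_bitsE (inj_eq (can_inj map_negbK)).
Qed.

End FixedOrder.
End TrieSoundness.

(** * Assembly of the table of counts *)

Lemma Nat_pow_expn a k : Nat.pow a k = (a ^ k)%N.
Proof. by elim: k => // k IH; rewrite expnS -IH. Qed.

Theorem theorem1p7 (R : realType) (N ocs ocsn ahm : nat) :
  (2 <= N <= 30)%N ->
  count_table N = (ocs, ocsn, ahm) ->
  [/\ OCS R N #= `I_ocs, OCSN R N #= `I_ocsn & AHM R N #= `I_ahm].
Proof.
move=> N_range tableN.
have : check_counts N by apply: (allP all_check_counts); rewrite mem_iota.
(* The polynomial and the approximation become variables: from here on only the outcomes of the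
   checks are used. *)
rewrite /check_counts tableN; case: (min_poly_data N) => psi a1; move: N_range {tableN}.
case: N => [|[|n]] // _ /and5P[].
case/and5P=> psi_gt0 lo hi exN /and3P[exN1 neq2 errs].
move=> /N.eqb_eq unk /N.eqb_eq ocsE /N.eqb_eq ocsnE /N.eqb_eq ahmE.
have [x root_x approx_x] := approx_root R (Zle_bool_imp_le _ _ lo) (Zle_bool_imp_le _ _ hi).
have entry_k k : (k <= n.+2)%N ->
    approximates psi x (cheb x k) (nth dummy (table psi a1 n.+2) k).
  exact: table_entry.
(* Equal residues modulo [psi] have equal values at its root x. *)
have chebN : cheb x n.+2 = 2.
  have [_ <- _] := entry_k _ (leqnn _); rewrite (eqP exN).
  by have [_ -> _] := entry_k 0%N isT.
have chebN1 : cheb x n.+1 = x.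
  have [_ <- _] := entry_k n.+1 (leqnSn _); rewrite (eqP exN1).
  by have [_ -> _] := entry_k 1%N isT.
have cheb_neq2 k : (0 < k < n.+2)%N -> cheb x k != 2.
  move=> /andP[k0 kN]; have := allP neq2 k.
  rewrite mem_iota k0 add1n kN => /(_ isT)/Z.ltb_lt/(lt_zr R).
  have [_ _] := entry_k k (ltnW kN); rewrite ler_distl zrD zrM zr2 => /andP[_ up] lt2.
  rewrite lt_eqF // -(ltr_pM2l (scale_gt0 R)); lra.
have c0 := chebc0 x n; have cM := chebcM chebN chebN1.
have csum := chebcsum chebN chebN1 cheb_neq2.
have table_ok k : (k < n.+2)%N ->
    approximates psi x (cheb x k) (nth dummy (table psi a1 n.+2) k).
  by move=> kN; apply: entry_k; apply: ltnW.
have err_ok k : (k < n.+2)%N -> (err (nth dummy (table psi a1 n.+2) k) <= 2 ^ 44)%ZZ.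
  by move=> kN; apply/Z.leb_le/(allP errs); rewrite mem_iota.
have no_unknown : N.to_nat (count_leaves is_unknown
    (sign_trie psi (table psi a1 n.+2) n.+2) [:: true]) = 0%N by rewrite unk.
have -> : ocs = (2 ^ n.+2./2.+1)%N.
  by rewrite -(Nat2N.id ocs) ocsE -(Nat2N.inj_pow 2) Nat2N.id Nat_pow_expn.
have -> : ocsn = count (@all_nz R n (cheb x)) (bitseqs n.+2./2.+1).
  rewrite (count_all_nz table_ok err_ok no_unknown).
  by rewrite -(Nat2N.id ocsn) ocsnE N2Nat.inj_double -mul2n.
have -> : ahm = count (@is_ahm R n (cheb x)) (bitseqs n.+2./2.+1).
  rewrite (count_is_ahm table_ok err_ok no_unknown).
  by rewrite -(Nat2N.id ahm) ahmE N2Nat.inj_double -mul2n.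
split; [exact: (card_OCS c0 cM csum)|exact: (card_OCSN c0 cM csum)|].
exact: (card_AHM c0 cM csum).
Qed.
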